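(* Let $k\ge 1$ be an integer and let $I\subset S=K[x_1,\ldots,x_n]$ ($K$ a field) be a $k$-Borel ideal. Then $I$ has linear quotients. In particular, $I$ is componentwise linear.
   Context: For a monomial ideal $I$, $G(I)$ is its unique minimal set of monomial generators; $\operatorname{supp}(u)=\{i: x_i\mid u\}$. A monomial $u=x_1^{a_1}\cdots x_n^{a_n}$ is $k$-bounded if $a_i\le k$ for all $i$; a monomial ideal is $k$-bounded if it is generated by $k$-bounded monomials. A $k$-bounded monomial ideal $I$ is $k$-Borel if for every $k$-bounded monomial $u\in I$, every $j\in\operatorname{supp}(u)$ and every $i<j$ one has $x_i(u/x_j)\in I$, provided $x_i(u/x_j)$ is $k$-bounded. A $k$-Borel ideal is not assumed to be generated in a single degree. A monomial ideal $I$ has linear quotients if the elements of $G(I)$ can be ordered $u_1,\ldots,u_m$ so that for every $2\le j\le m$ the colon ideal $(u_1,\ldots,u_{j-1}):(u_j)$ is generated by a subset of the variables. A graded ideal $I$ is componentwise linear if for every $d$ the ideal generated by all homogeneous elements of degree $d$ in $I$ has a $d$-linear resolution (or is zero). *)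

(* Defs.v *)
From HB Require Import structures.
From mathcomp Require Import all_boot all_order all_algebra.
From mathcomp Require Import mpoly.

Set Implicit Arguments.
Unset Strict Implicit.
Unset Printing Implicit Defensive.

Import GRing.Theory.
Local Open Scope ring_scope.

(* Ideals are Prop-valued predicates on {mpoly K[n]}, compared extensionally.
   The ideals of ring_quotient.v are proper by definition, whereas the unit
   ideal has to be allowed here. *)

Definition ideal_gen (K : fieldType) (n : nat) (A : {mpoly K[n]} -> Prop)
    (f : {mpoly K[n]}) : Prop :=
  exists (m : nat) (c g : 'I_m -> {mpoly K[n]}),
    (forall i, A (g i)) /\ f = \sum_(i < m) c i * g i.

Definition monomials (K : fieldType) (n : nat) (A : 'X_{1..n} -> Prop)
    (f : {mpoly K[n]}) : Prop :=
  exists2 u : 'X_{1..n}, A u & f = 'X_[u].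

Definition variables (K : fieldType) (n : nat) (V : {set 'I_n})
    (f : {mpoly K[n]}) : Prop :=
  exists2 i : 'I_n, i \in V & f = 'X_i.

Definition colon (K : fieldType) (n : nat) (I J : {mpoly K[n]} -> Prop)
    (f : {mpoly K[n]}) : Prop :=
  forall g, J g -> I (f * g).

Definition generates (K : fieldType) (n : nat) (A : 'X_{1..n} -> Prop)
    (I : {mpoly K[n]} -> Prop) : Prop :=
  forall f, I f <-> ideal_gen (monomials A) f.

(* A is G(I). *)
Definition minimal_monomial_generators (K : fieldType) (n : nat)
    (I : {mpoly K[n]} -> Prop) (A : 'X_{1..n} -> Prop) : Prop :=
  generates A I /\
  forall B : 'X_{1..n} -> Prop,
    (forall u, B u -> A u) -> generates B I -> forall u, A u -> B u.

Definition bounded_mon (k n : nat) (u : 'X_{1..n}) : Prop :=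
  forall i : 'I_n, (u i <= k)%N.

Definition bounded_monomial_ideal (K : fieldType) (k n : nat)
    (I : {mpoly K[n]} -> Prop) : Prop :=
  exists2 A : 'X_{1..n} -> Prop,
    (forall u, A u -> bounded_mon k u) & generates A I.

Definition supp (n : nat) (u : 'X_{1..n}) : {set 'I_n} :=
  [set i | (0 < u i)%N].

(* The subtraction u - U_(j) is truncated, hence exact only for j \in supp u. *)
Definition borel_move (n : nat) (u : 'X_{1..n}) (i j : 'I_n) : 'X_{1..n} :=
  (U_(i) + (u - U_(j)))%MM.

Definition k_Borel (K : fieldType) (k n : nat)
    (I : {mpoly K[n]} -> Prop) : Prop :=
  bounded_monomial_ideal k I /\
  forall (u : 'X_{1..n}) (i j : 'I_n),
    bounded_mon k u -> I 'X_[u] -> j \in supp u -> (i < j)%N ->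
    bounded_mon k (borel_move u i j) -> I 'X_[borel_move u i j].

Definition has_linear_quotients (K : fieldType) (n : nat)
    (I : {mpoly K[n]} -> Prop) : Prop :=
  exists s : seq 'X_{1..n},
    [/\ uniq s,
        minimal_monomial_generators I (fun u => u \in s)
      & forall j : nat, (0 < j < size s)%N ->
          exists V : {set 'I_n}, forall f : {mpoly K[n]},
            colon (ideal_gen (monomials (fun u => u \in take j s)))
                  (ideal_gen (monomials (fun u => u = nth 0%MM s j))) f
            <-> ideal_gen (variables V) f].

(* A graded free resolution  ... -> F_2 -> F_1 -> F_0 -> I -> 0  with
   F_i = \bigoplus_j S(- twist i j).  Elements of F_i are row vectors, and maps
   act by right multiplication.  The homogeneity conditions say that all maps
   have degree 0 with respect to the twisted gradings. *)
Record graded_free_resolution (K : fieldType) (n : nat)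
    (I : {mpoly K[n]} -> Prop) : Type := GradedFreeResolution {
  rank : nat -> nat;
  twist : forall i : nat, 'I_(rank i) -> nat;
  augm : 'cV[{mpoly K[n]}]_(rank 0);
  diff : forall i : nat, 'M[{mpoly K[n]}]_(rank i.+1, rank i);
  augm_homog : forall j : 'I_(rank 0), augm j 0 \is (twist j).-homog;
  diff_homog : forall (i : nat) (j : 'I_(rank i.+1)) (l : 'I_(rank i))
      (m : 'X_{1..n}),
    m \in msupp (diff i j l) -> (mdeg m + twist l)%N = twist j;
  augm_image : forall f : {mpoly K[n]},
    I f <-> exists v : 'rV[{mpoly K[n]}]_(rank 0), (v *m augm) 0 0 = f;
  augm_exact : forall v : 'rV[{mpoly K[n]}]_(rank 0),
    v *m augm = 0 <-> exists w : 'rV[{mpoly K[n]}]_(rank 1), w *m diff 0 = v;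
  diff_exact : forall (i : nat) (v : 'rV[{mpoly K[n]}]_(rank i.+1)),
    v *m diff i = 0 <->
    exists w : 'rV[{mpoly K[n]}]_(rank i.+2), w *m diff i.+1 = v
}.

(* The differentials map F_(i+1) into (x_1, ..., x_n) F_i. *)
Definition minimal_resolution (K : fieldType) (n : nat)
    (I : {mpoly K[n]} -> Prop) (F : graded_free_resolution I) : Prop :=
  forall (i : nat) (j : 'I_(rank F i.+1)) (l : 'I_(rank F i)),
    (diff F i j l)@_0%MM = 0.

(* The minimal graded free resolution is unique up to isomorphism, so asking
   for one with the prescribed twists is a condition on I. *)
Definition has_linear_resolution (K : fieldType) (n : nat) (d : nat)
    (I : {mpoly K[n]} -> Prop) : Prop :=
  exists2 F : graded_free_resolution I,
    minimal_resolution F &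
    forall (i : nat) (j : 'I_(rank F i)), twist j = (d + i)%N.

Definition degree_component_ideal (K : fieldType) (n : nat) (d : nat)
    (I : {mpoly K[n]} -> Prop) : {mpoly K[n]} -> Prop :=
  ideal_gen (fun f => I f /\ f \is d.-homog).

Definition componentwise_linear (K : fieldType) (n : nat)
    (I : {mpoly K[n]} -> Prop) : Prop :=
  forall d : nat,
    has_linear_resolution d (degree_component_ideal d I) \/
    (forall f, degree_component_ideal d I f -> f = 0).

(* Main.v *)
Require Import Defs.
From mathcomp Require Import all_boot all_order all_algebra.
From mathcomp Require Import zify mpoly.
From mathcomp Require Import boolp.

Set Implicit Arguments.
Unset Strict Implicit.
Unset Printing Implicit Defensive.

Import GRing.Theory.
Local Open Scope ring_scope.

(** The minimal generators of a k-Borel ideal [I] are k-bounded, hence finite in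
    number. List them by increasing degree and, within a degree, by increasing
    weight, where the weight of [u] is the sum of the [i * u_i]: replacing a
    variable by an earlier one makes a monomial lighter.

    Let [u'] precede [u]. It is enough to find [i < j] such that [u'] has more
    of [x_i] than [u] and [x_j] divides [u]: then [x_i (u / x_j)] is k-bounded
    and belongs to [I], so one of the generators preceding [u] divides [x_i u],
    and [x_i] divides [u' / gcd(u, u')]. When [u] and [u'] have the same degree,
    such a pair exists because [u'] is not heavier than [u] ([mnmwgt_le_ex]).
    When [u'] has smaller degree, the absence of such a pair would allow Borel
    moves on [u'] until it divides [u], against the minimality of [u]
    ([kBorel_lower_degree]).

    Linear quotients by increasing degree pass to the ideals generated by the
    degree components ([monomial_lq_degree_part]): each monomial of degree [d]
    of [I] is attached to the first generator that divides it, and those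
    attached to one generator are listed by weight.

    It remains to see that an ideal generated in one degree with linear
    quotients has a linear resolution. Consider more generally the rows of a
    matrix with homogeneous entries of one degree, such that the ideal of
    leading coefficients of the syzygies ending at row [j] is generated by a set
    [V_j] of variables. Choosing a syzygy with linear entries for each [j] and
    each variable of [V_j] gives a generating set of all syzygies, by cancelling
    leading coefficients ([syz_mx_span]). Listed by [j] and then by variable, it
    has the same property ([syz_mx_linear]): the leading coefficients of the
    syzygies ending at [(j, v)] form the ideal of the variables of [V_j] that
    come before [v], as these ideals are prime and the S-pairs of two syzygies
    with the same [j] reduce to zero. Iterating this gives the resolution. *)

(** * Monomials: divisibility, degree and weight *)

Lemma lem_mdeg n (u v : 'X_{1..n}) : (u <= v)%MM -> (mdeg u <= mdeg v)%N.
Proof. by move=> uv; rewrite -(submK uv) mdegD leq_addl. Qed.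

Lemma mdeg_le_ex n (u v : 'X_{1..n}) :
  (mdeg u <= mdeg v)%N -> u != v -> exists i, (u i < v i)%N.
Proof.
move=> deg_uv uv; have [/existsP[i] | /existsPn h] := boolP [exists i, (u i < v i)%N].
  by exists i.
have vu : (v <= u)%MM by apply/mnm_lepP => i; have := h i; lia.
move: deg_uv uv; rewrite -(submK vu) mdegD => deg0.
have /eqP : mdeg (u - v) = 0%N by lia.
by rewrite mdeg_eq0 => /eqP ->; rewrite add0m eqxx.
Qed.

Lemma mdeg_subU n (u : 'X_{1..n}) i : (0 < u i)%N -> (mdeg (u - U_(i))).+1 = mdeg u.
Proof.
move=> ui; have /submK/(congr1 (@mdeg n)) : (U_(i) <= u)%MM by rewrite lep1mP -lt0n.
by rewrite mdegD mdeg1 addn1.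
Qed.

Lemma lem_proper_ex n (u v : 'X_{1..n}) :
  (u <= v)%MM -> u != v -> exists2 i, (0 < v i)%N & (u <= v - U_(i))%MM.
Proof.
move=> uv neq_uv.
have [i lt_i] := mdeg_le_ex (lem_mdeg uv) neq_uv.
exists i; first by lia.
apply/mnm_lepP => j; have := mnm_lepP uv j.
by rewrite mnmBE mnm1E; case: eqP => [<-|_] /=; lia.
Qed.

Lemma borel_moveE n (u : 'X_{1..n}) i j l :
  borel_move u i j l = ((i == l) + (u l - (j == l)))%N.
Proof. by rewrite mnmDE mnmBE !mnm1E. Qed.

Lemma mdeg_borel_move n (u : 'X_{1..n}) i j :
  (0 < u j)%N -> mdeg (borel_move u i j) = mdeg u.
Proof. by move=> uj; rewrite mdegD mdeg1 add1n mdeg_subU. Qed.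

Lemma mnmwgt_borel_move n (u : 'X_{1..n}) (i j : 'I_n) :
  (0 < u j)%N -> (i < j)%N -> (mnmwgt (borel_move u i j) < mnmwgt u)%N.
Proof.
move=> uj ij; have le_ju : (U_(j) <= u)%MM by rewrite lep1mP -lt0n.
rewrite /borel_move mnmwgtD mnmwgt1 -{2}(submK le_ju) mnmwgtD mnmwgt1; lia.
Qed.

Lemma borel_move_le n (u : 'X_{1..n}) (i j : 'I_n) :
  (borel_move u i j <= u + U_(i))%MM.
Proof. by rewrite addmC; apply/mnm_lepP => l; rewrite !mnmDE leq_add2l mnmBE leq_subr. Qed.

(** A monomial that is at most as heavy as a different one of the same degree
    is larger at some variable and smaller at a later one. *)
Lemma mnmwgt_le_ex n (u v : 'X_{1..n}) :
  mdeg u = mdeg v -> (mnmwgt u <= mnmwgt v)%N -> u != v ->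
  exists i j : 'I_n, [/\ (i < j)%N, (v i < u i)%N & (u j < v j)%N].
Proof.
move=> deg_uv wgt_uv neq_uv.
have [i0 ui0] : exists i, (v i < u i)%N.
  by apply: mdeg_le_ex; rewrite ?deg_uv // eq_sym.
pose i := [arg min_(l < i0 | (v l < u l)%N) (l : nat)].
have [ui i_min] : (v i < u i)%N /\ forall l, (v l < u l)%N -> (i <= l)%N.
  by rewrite /i; case: arg_minnP.
have [j uj] := mdeg_le_ex (eq_leq deg_uv) neq_uv.
have [ij|ji] := ltnP i j; first by exists i, j.
have [/existsP[l /andP[il ul]] | /existsPn h] :=
  boolP [exists l : 'I_n, (i < l)%N && (u l < v l)%N]; first by exists i, l.
(* otherwise u - v is nonpositive before i and nonnegative from i on *)
have term l : (v l * l.+1 + u l * i.+1 <= u l * l.+1 + v l * i.+1)%N.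
  have [il|li] := ltnP i l; first by have := h l; rewrite il /=; nia.
  have [->|] := eqVneq l i; first by lia.
  rewrite -(inj_eq val_inj) /= => neq_li.
  have : (u l <= v l)%N by rewrite leqNgt; apply/negP => /i_min; lia.
  by nia.
have termj : (v j * j.+1 + u j * i.+1 < u j * j.+1 + v j * i.+1)%N.
  have : (j < i)%N.
    rewrite ltn_neqAle ji andbT; apply: contraTN uj => /eqP /val_inj ->.
    by rewrite -leqNgt ltnW.
  by nia.
have : (mnmwgt v + mdeg u * i.+1 < mnmwgt u + mdeg v * i.+1)%N.
  rewrite !mdegE /mnmwgt !big_distrl /= -!big_split /=.
  rewrite (bigD1 j) //= [X in (_ < X)%N](bigD1 j) //= -addSn leq_add //.
  by apply: leq_sum => l _; apply: term.
by rewrite deg_uv; lia.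
Qed.

(** * Linear quotients of a sequence of monomials *)

(** Linear quotients for the monomials of [s], in the given order, expressed by
    divisibility alone: whenever [u'] precedes [u], some variable dividing
    [u' / gcd(u, u')] multiplies [u] into the ideal of its predecessors. *)
Definition monomial_lq n (s : seq 'X_{1..n}) : Prop :=
  forall u u', u \in s -> u' \in s -> (index u' s < index u s)%N ->
  exists2 a, (u a < u' a)%N &
  exists2 v, (v \in s) && (index v s < index u s)%N & (v <= u + U_(a))%MM.

(** Elements that are tied for [r] may be listed in any order. *)
Lemma monomial_lq_sort n (r : rel 'X_{1..n}) s :
  total r -> transitive r ->
  (forall u u', u \in s -> u' \in s -> u' != u -> r u' u ->
   exists2 a, (u a < u' a)%N &
   exists2 v, (v \in s) && ~~ r u v & (v <= u + U_(a))%MM) ->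
  monomial_lq (sort r s).
Proof.
move=> r_tot r_tr H u u'; rewrite !mem_sort => us u's lt_u'u.
have srt := sort_sorted r_tot s.
have r_refl : reflexive r by move=> x; have := r_tot x x; rewrite orbb.
have neq_u'u : u' != u by apply: contraTneq lt_u'u => ->; rewrite ltnn.
have r_u'u : r u' u.
  by apply: (sorted_leq_index r_tr r_refl srt); rewrite ?mem_sort // ltnW.
have [a ua [v /andP[vs nr_uv] le_v]] := H u u' us u's neq_u'u r_u'u.
exists a => //; exists v => //; rewrite mem_sort vs /= ltnNge.
apply: contraNN nr_uv => le_uv.
by apply: (sorted_leq_index r_tr r_refl srt); rewrite ?mem_sort.
Qed.

(** Comparison of [f] first and of [g] in case of a tie. *)
Definition lexrel T (f g : T -> nat) : rel T :=
  fun u v => (f u < f v)%N || (f u == f v) && (g u <= g v)%N.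

Lemma lexrel_total T (f g : T -> nat) : total (lexrel f g).
Proof. by move=> u v; rewrite /lexrel; lia. Qed.

Lemma lexrel_trans T (f g : T -> nat) : transitive (lexrel f g).
Proof. by move=> v u w; rewrite /lexrel; lia. Qed.

(** The monomials of degree at most [d] that satisfy [P]. *)
Definition mons_upto n (d : nat) (P : pred 'X_{1..n}) : seq 'X_{1..n} :=
  [seq m <- [seq val x | x : 'X_{1..n < d.+1}] | P m].

Lemma mem_mons_upto n d (P : pred 'X_{1..n}) m :
  (m \in mons_upto d P) = (mdeg m <= d)%N && P m.
Proof.
rewrite mem_filter andbC; congr andb; apply/imageP/idP => [[x _ ->]|le_m].
  by have := bmdeg x; rewrite ltnS.
by exists (BMultinom (le_m : (mdeg m < d.+1)%N)).
Qed.

Lemma uniq_mons_upto n d (P : pred 'X_{1..n}) : uniq (mons_upto d P).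
Proof. by rewrite filter_uniq // map_inj_uniq ?enum_uniq //; apply: val_inj. Qed.

(** The position of the first member of [s] that divides [w]. *)
Definition first_div n (s : seq 'X_{1..n}) (w : 'X_{1..n}) : nat :=
  find (fun u => u <= w)%MM s.

Lemma first_div_le n (s : seq 'X_{1..n}) u w :
  u \in s -> (u <= w)%MM -> (first_div s w <= index u s)%N.
Proof.
move=> us uw; rewrite leqNgt; apply/negP => /(before_find u).
by rewrite nth_index // uw.
Qed.

Lemma index_nth_le (T : eqType) (x0 : T) s i : (index (nth x0 s i) s <= i)%N.
Proof.
by rewrite leqNgt; apply/negP => /(before_find x0); rewrite /= eqxx.
Qed.

(** The monomials of degree [d] in the ideal generated by [s], listed by the
    first member of [s] dividing them, then by weight. *)
Definition degree_part n (s : seq 'X_{1..n}) (d : nat) : seq 'X_{1..n} :=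
  sort (lexrel (first_div s) (@mnmwgt n))
    (mons_upto d [pred w | (mdeg w == d) && has (fun u => u <= w)%MM s]).

Lemma mem_degree_part n (s : seq 'X_{1..n}) d w :
  (w \in degree_part s d) = (mdeg w == d) && has (fun u => u <= w)%MM s.
Proof. by rewrite mem_sort mem_mons_upto /=; case: eqP => [->|]; rewrite ?leqnn ?andbF. Qed.

Lemma uniq_degree_part n (s : seq 'X_{1..n}) d : uniq (degree_part s d).
Proof. by rewrite sort_uniq uniq_mons_upto. Qed.

(** Linear quotients pass to the ideals generated by the degree components,
    provided that the generators are listed by increasing degree. *)
Lemma monomial_lq_degree_part n (s : seq 'X_{1..n}) d :
  monomial_lq s ->
  {in s &, forall u v, (index u s <= index v s -> mdeg u <= mdeg v)%N} ->
  monomial_lq (degree_part s d).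
Proof.
move=> lqs degs; apply: monomial_lq_sort; [exact: lexrel_total|exact: lexrel_trans|].
move=> w w'; rewrite !mem_mons_upto /= => /and3P[_ /eqP dw hw] /and3P[_ /eqP dw' hw'].
move=> neq_w'w; rewrite /lexrel.
pose u := nth 0%MM s (first_div s w); pose u' := nth 0%MM s (first_div s w').
have uw : (u <= w)%MM by apply: (nth_find _ hw).
have u'w' : (u' <= w')%MM by apply: (nth_find _ hw').
have us : u \in s by rewrite mem_nth // -has_find.
have u's : u' \in s by rewrite mem_nth // -has_find.
have first_le_u w1 : (u <= w1)%MM -> (first_div s w1 <= first_div s w)%N.
  by move=> uw1; apply: leq_trans (index_nth_le 0%MM s _); apply: first_div_le.
have idx_u : index u s = first_div s w.
  by apply/eqP; rewrite eqn_leq first_div_le // index_nth_le.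
have idx_u' : (index u' s <= first_div s w')%N by apply: index_nth_le.
case/orP => [lt_w'w | /andP[/eqP eq_w'w le_wgt]].
  have [|a ua [v /andP[vs lt_vu] le_v]] := lqs u u' us u's.
    by rewrite idx_u (leq_ltn_trans idx_u').
  (* w has no more of the variable a than u: otherwise v would divide w *)
  have wa : w a = u a.
    apply/eqP; rewrite eqn_leq (mnm_lepP uw) andbT leqNgt; apply/negP => lt_a.
    suff /(first_div_le vs) : (v <= w)%MM by rewrite -idx_u leqNgt lt_vu.
    apply/mnm_lepP => l; apply: leq_trans (mnm_lepP le_v l) _.
    rewrite mnmDE mnm1E; case: eqP => [<-|_]; first by rewrite addn1.
    by rewrite addn0; apply: (mnm_lepP uw).
  have vwa : (v <= w + U_(a))%MM.
    apply: lepm_trans le_v _; apply/mnm_lepP => l.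
    by rewrite !mnmDE leq_add2r (mnm_lepP uw).
  have dv : (mdeg v <= d)%N.
    rewrite -dw; apply: leq_trans (lem_mdeg uw); apply: degs => //; exact: ltnW.
  (* v has degree at most d, so w x_a can be divided by some x_c and remain a
     multiple of v: this brings it back to degree d *)
  have [|c wc vwc] := lem_proper_ex vwa.
    by apply: contraTneq dv => ->; rewrite mdegD mdeg1 dw addn1 ltnn.
  exists a; first by rewrite wa; apply: leq_trans ua (mnm_lepP u'w' a).
  exists (w + U_(a) - U_(c))%MM; last exact: lem_subr.
  rewrite mem_mons_upto /=.
  have /eqP := mdeg_subU wc; rewrite mdegD mdeg1 dw addn1 eqSS => /eqP ->.
  rewrite leqnn eqxx /=; apply/andP; split; first by apply/hasP; exists v.
  have lt_first := leq_ltn_trans (first_div_le vs vwc) lt_vu.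
  by rewrite -idx_u negb_or -leqNgt ltnW // gtn_eqF.
have [i [j [ij wi wj]]] := mnmwgt_le_ex (etrans dw' (esym dw)) le_wgt neq_w'w.
exists i => //; exists (borel_move w i j); last exact: borel_move_le.
have uw1 : (u <= borel_move w i j)%MM.
  apply/mnm_lepP => l; rewrite borel_moveE; have := mnm_lepP uw l.
  have : (u l <= w' l)%N by move: u'w' => /mnm_lepP /(_ l); rewrite /u' eq_w'w.
  by clear -wj; have [<-|_] := eqVneq j l; lia.
have wj0 : (0 < w j)%N by apply: leq_ltn_trans wj.
rewrite mem_mons_upto /= mdeg_borel_move // dw leqnn eqxx /=.
apply/andP; split; first by apply/hasP; exists u.
rewrite negb_or negb_and -leqNgt -ltnNge first_le_u //=.
by rewrite mnmwgt_borel_move // orbT.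
Qed.

(** * Minimal generators of a k-Borel ideal *)

(** The minimal elements for divisibility of a set [J] of monomials. *)
Definition minimal_mon n (J : pred 'X_{1..n}) (u : 'X_{1..n}) : bool :=
  J u && [forall i, (0 < u i)%N ==> ~~ J (u - U_(i))%MM].

Lemma minimal_mon_exists n (J : pred 'X_{1..n}) m :
  J m -> exists2 u, minimal_mon J u & (u <= m)%MM.
Proof.
have [d] := ubnP (mdeg m); elim: d m => // d IH m le_d Jm.
have [/forallP min_m | /forallPn[i]] :=
    boolP [forall i, (0 < m i)%N ==> ~~ J (m - U_(i))%MM].
  by exists m; [rewrite /minimal_mon Jm; apply/forallP | exact: lepm_refl].
rewrite negb_imply negbK => /andP[mi Jmi].
have [|u min_u le_u] := IH _ _ Jmi; first by rewrite mdeg_subU.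
by exists u => //; apply: lepm_trans le_u (lem_subr _ _).
Qed.

Lemma minimal_mon_uniq n (J : pred 'X_{1..n}) u v :
  (forall u v, J u -> (u <= v)%MM -> J v) ->
  minimal_mon J u -> J v -> (v <= u)%MM -> v = u.
Proof.
move=> J_up /andP[_ /forallP min_u] Jv vu; apply/eqP; apply: contraT => neq_vu.
have [i ui le_vu] := lem_proper_ex vu neq_vu.
by have := min_u i; rewrite ui (J_up _ _ Jv le_vu).
Qed.

(** The set of monomials of a k-Borel ideal. *)
Record kBorel_mons n (k : nat) (J : pred 'X_{1..n}) : Prop := {
  kBorel_up : forall u v, J u -> (u <= v)%MM -> J v;
  kBorel_bounded : forall u, minimal_mon J u -> bounded_mon k u;
  kBorel_move : forall u (i j : 'I_n), bounded_mon k u -> J u -> (0 < u j)%N ->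
    (i < j)%N -> bounded_mon k (borel_move u i j) -> J (borel_move u i j)
}.

(** As long as the variables at which [v] exceeds [u] all come after those at
    which it falls short of [u], a Borel move takes [v] closer to [u]; this
    cannot go on until [v] divides [u], because [u] is minimal. *)
Lemma kBorel_lower_degree n k (J : pred 'X_{1..n}) u v :
  kBorel_mons k J -> minimal_mon J u -> J v -> bounded_mon k v ->
  (mdeg v < mdeg u)%N ->
  exists i j : 'I_n, [/\ (i < j)%N, (u i < v i)%N & (0 < u j)%N].
Proof.
move=> Jk min_u; have [d] := ubnP (mdeg (v - u)).
elim: d v => // d IH v le_d Jv bv dvu.
have [b vb] : exists i, (v i < u i)%N.
  by apply: mdeg_le_ex; [exact: ltnW | apply: contraTneq dvu => ->; rewrite ltnn].
have [/existsP[a va] | /existsPn vu] := boolP [exists i, (u i < v i)%N]; last first.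
  move: dvu; rewrite (minimal_mon_uniq (kBorel_up Jk) min_u Jv) ?ltnn //.
  by apply/mnm_lepP => i; rewrite leqNgt vu.
have [ab|ba] := ltnP a b; first by exists a, b; split=> //; apply: leq_ltn_trans vb.
have neq_ba : b != a by apply: contraTneq vb => ->; rewrite -leqNgt ltnW.
have {}ba : (b < a)%N by rewrite ltn_neqAle ba andbT.
have va0 : (0 < v a)%N by apply: leq_ltn_trans va.
pose v' := borel_move v b a.
(* the exponent that increases is still at most that of u, which is at most k *)
have bv' : bounded_mon k v'.
  move=> i; rewrite borel_moveE; have := bv i.
  have := kBorel_bounded Jk min_u b.
  by have [<-|_] := eqVneq b i; lia.
have Jv' : J v' by apply: (kBorel_move Jk).
have dv' : mdeg v' = mdeg v by rewrite mdeg_borel_move.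
have lt_d : (mdeg (v' - u) < d)%N.
  rewrite -ltnS; apply: leq_trans le_d; rewrite ltnS.
  have <- : ((v' - u) + U_(a) = v - u)%MM.
    apply/mnmP => i; rewrite mnmDE !mnmBE mnm1E borel_moveE.
    have [<-|_] := eqVneq a i; first by rewrite (negbTE neq_ba); lia.
    by have [<-|_] := eqVneq b i; lia.
  by rewrite mdegD mdeg1 addn1.
have [|i [j [ij vi uj]]] := IH v' lt_d Jv' bv'; first by rewrite dv'.
exists i, j; split=> //; move: vi; rewrite borel_moveE.
by have [<-|_] := eqVneq b i; lia.
Qed.

Lemma mdeg_bounded n k (u : 'X_{1..n}) : bounded_mon k u -> (mdeg u <= n * k)%N.
Proof.
move=> bu; rewrite mdegE -[X in (_ <= X * _)%N]card_ord -sum_nat_const.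
by apply: leq_sum => i _; apply: bu.
Qed.

(** The minimal generators, by increasing degree, then by increasing weight. *)
Definition kBorel_gens n (k : nat) (J : pred 'X_{1..n}) : seq 'X_{1..n} :=
  sort (lexrel (@mdeg n) (@mnmwgt n)) (mons_upto (n * k) (minimal_mon J)).

Section KBorelGens.
Variables (n k : nat) (J : pred 'X_{1..n}).
Hypothesis Jk : kBorel_mons k J.

Lemma mem_kBorel_gens u : (u \in kBorel_gens k J) = minimal_mon J u.
Proof.
rewrite mem_sort mem_mons_upto andb_idl // => min_u.
exact/mdeg_bounded/(kBorel_bounded Jk).
Qed.

Lemma uniq_kBorel_gens : uniq (kBorel_gens k J).
Proof. by rewrite sort_uniq uniq_mons_upto. Qed.

Lemma kBorel_gens_mdeg :
  {in kBorel_gens k J &, forall u v,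
    (index u (kBorel_gens k J) <= index v (kBorel_gens k J) -> mdeg u <= mdeg v)%N}.
Proof.
move=> u v us vs le_uv.
suff: lexrel (@mdeg n) (@mnmwgt n) u v by rewrite /lexrel; lia.
have refl : reflexive (lexrel (@mdeg n) (@mnmwgt n)) by move=> x; rewrite /lexrel; lia.
apply: (sorted_leq_index (@lexrel_trans _ _ _) refl _ _ _ us vs le_uv).
exact/sort_sorted/lexrel_total.
Qed.

Lemma monomial_lq_kBorel_gens : monomial_lq (kBorel_gens k J).
Proof.
apply: monomial_lq_sort; [exact: lexrel_total|exact: lexrel_trans|].
move=> u u'; rewrite -(mem_sort (lexrel (@mdeg n) (@mnmwgt n))) mem_kBorel_gens.
rewrite -[u' \in _](mem_sort (lexrel (@mdeg n) (@mnmwgt n))) mem_kBorel_gens.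
move=> min_u min_u' neq_u'u r_u'u.
have bu := kBorel_bounded Jk min_u; have bu' := kBorel_bounded Jk min_u'.
have [/andP[Ju _] /andP[Ju' _]] := (min_u, min_u').
have [i [j [ij ui uj]]] : exists i j : 'I_n, [/\ (i < j)%N, (u i < u' i)%N & (0 < u j)%N].
  case/orP: r_u'u => [lt_deg | /andP[/eqP eq_deg le_wgt]].
    exact: (kBorel_lower_degree Jk min_u Ju').
  have [i [j [ij ui uj]]] := mnmwgt_le_ex eq_deg le_wgt neq_u'u.
  by exists i, j; split=> //; apply: leq_ltn_trans uj.
exists i => //; pose w := borel_move u i j.
have Jw : J w.
  apply: (kBorel_move Jk) => // l; rewrite borel_moveE.
  by have := bu l; have := bu' l; have [<-|_] := eqVneq i l; lia.
have [v min_v vw] := minimal_mon_exists Jw.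
exists v; last by apply: lepm_trans vw (borel_move_le _ _ _).
rewrite -(mem_sort (lexrel (@mdeg n) (@mnmwgt n))) mem_kBorel_gens min_v /=.
have [->|neq_vw] := eqVneq v w.
  rewrite /lexrel negb_or negb_and -leqNgt -ltnNge mdeg_borel_move // leqnn.
  by rewrite mnmwgt_borel_move // orbT.
have [l wl vwl] := lem_proper_ex vw neq_vw.
have dvw : (mdeg v < mdeg w)%N.
  by rewrite -(mdeg_subU wl) ltnS lem_mdeg.
move: dvw; rewrite mdeg_borel_move // /lexrel => dvu.
by rewrite negb_or -leqNgt ltnW // gtn_eqF.
Qed.

End KBorelGens.

(** * Monomial ideals and ideals of variables *)

Lemma msupp_sumP (R : nzRingType) n (T : finType) (P : pred T)
    (F : T -> {mpoly R[n]}) m :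
  m \in msupp (\sum_(i | P i) F i) -> exists2 i, P i & m \in msupp (F i).
Proof.
move=> /msupp_sum_le /flattenP[ms /mapP[i]].
by rewrite mem_filter => /andP[Pi _] -> m_i; exists i.
Qed.

Section MonomialIdeals.
Variables (K : fieldType) (n : nat).
Implicit Types (f g : {mpoly K[n]}) (A : 'X_{1..n} -> Prop).

(** A polynomial lies in a monomial ideal when each of its monomials is
    divisible by one of the generators. *)
Lemma ideal_gen_monomialsP A f :
  ideal_gen (monomials A) f <->
  forall m, m \in msupp f -> exists2 u, A u & (u <= m)%MM.
Proof.
split=> [[r [c [g [g_mon ->]]]] m /msupp_sumP[i _] | H].
  have [u Au ->] := g_mon i.
  rewrite (perm_mem (msuppMX _ _)) => /mapP[m' _ ->].
  by exists u => //; apply: lem_addr.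
have /choice[u Hu] : forall i : 'I_(size (msupp f)),
    exists u, A u /\ (u <= nth 0%MM (msupp f) i)%MM.
  by move=> i; have [|u Au le_u] := H (nth 0%MM (msupp f) i); [exact: mem_nth | exists u].
pose m (i : 'I_(size (msupp f))) := nth 0%MM (msupp f) i.
exists (size (msupp f)), (fun i => f@_(m i) *: 'X_[m i - u i]), (fun i => 'X_[u i]).
split=> [i|]; first by exists (u i) => //; case: (Hu i).
rewrite {1}[f]mpolyE (big_nth 0%MM) big_mkord; apply: eq_bigr => i _.
by rewrite -scalerAl -mpolyXD submK //; case: (Hu i).
Qed.

Lemma ideal_gen_mono (A B : {mpoly K[n]} -> Prop) f :
  (forall g, A g -> B g) -> ideal_gen A f -> ideal_gen B f.
Proof. by move=> AB [r [c [g [Ag ->]]]]; exists r, c, g; split=> // i; apply: AB. Qed.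

(** Membership in the ideal generated by the variables of [V], read off the
    monomials of [f]. *)
Definition in_variables (V : {set 'I_n}) f : Prop :=
  forall m, m \in msupp f -> exists2 a, a \in V & (0 < m a)%N.

Lemma ideal_gen_variablesP (V : {set 'I_n}) f :
  ideal_gen (variables V) f <-> in_variables V f.
Proof.
pose A (u : 'X_{1..n}) := exists2 a, a \in V & u = U_(a)%MM.
have eqA : ideal_gen (variables V) f <-> ideal_gen (monomials A) f.
  split; apply: ideal_gen_mono => g; first by case=> a Va ->; exists U_(a)%MM => //; exists a.
  by case=> _ [a Va ->] ->; exists a.
rewrite eqA ideal_gen_monomialsP; split=> H m /H.
  by case=> _ [a Va ->]; rewrite lep1mP -lt0n => ma; exists a.
by case=> a Va ma; exists U_(a)%MM; [exists a | rewrite lep1mP -lt0n].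
Qed.

Lemma in_variables_sum (V : {set 'I_n}) f :
  in_variables V f -> exists c, f = \sum_(a in V) c a * 'X_a.
Proof.
move=> fV; rewrite [f]mpolyE big_seq.
apply: (big_ind (fun g => exists c, g = \sum_(a in V) c a * 'X_a)).
- by exists (fun=> 0); rewrite big1 // => a _; rewrite mul0r.
- move=> _ _ [c1 ->] [c2 ->]; exists (fun a => c1 a + c2 a).
  by rewrite -big_split; apply: eq_bigr => a _; rewrite mulrDl.
move=> m /fV[a Va ma].
exists (fun b => if b == a then f@_m *: 'X_[m - U_(a)] else 0).
rewrite (bigD1 a) //= eqxx big1 => [|b /andP[_ /negbTE->]]; last by rewrite mul0r.
by rewrite addr0 -scalerAl -mpolyXD submK // lep1mP -lt0n.
Qed.

Lemma memI_monomial A (I : {mpoly K[n]} -> Prop) u :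
  generates A I -> I 'X_[u] <-> exists2 v, A v & (v <= u)%MM.
Proof.
move=> genI; rewrite genI ideal_gen_monomialsP msuppX.
split=> [H|H m]; first by apply: H; rewrite mem_head.
by rewrite inE => /eqP ->.
Qed.

(** The variables that multiply the [j]-th member of [s], counting from 0, into
    the ideal of the preceding ones. *)
Definition colon_vars (s : seq 'X_{1..n}) (j : nat) : {set 'I_n} :=
  [set a | has (fun v => v <= nth 0 s j + U_(a))%MM (take j s)].

Lemma colon_varsP (s : seq 'X_{1..n}) j m :
  uniq s -> monomial_lq s -> (j < size s)%N ->
  (exists2 u, u \in take j s & (u <= nth 0 s j + m)%MM) ->
  exists2 a, a \in colon_vars s j & (0 < m a)%N.
Proof.
move=> uniq_s lqs ltj [u /[dup] /mem_take us u_lt le_u].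
rewrite in_take // in u_lt.
have [||a lt_a [v /andP[vs v_lt] le_v]] := lqs (nth 0%MM s j) u _ us.
- exact: mem_nth.
- by rewrite index_uniq.
exists a; last by have := mnm_lepP le_u a; rewrite mnmDE; lia.
rewrite index_uniq // in v_lt.
by rewrite inE; apply/hasP; exists v; rewrite ?in_take.
Qed.

Lemma monomial_lq_colon (s : seq 'X_{1..n}) j f :
  uniq s -> monomial_lq s -> (j < size s)%N ->
  colon (ideal_gen (monomials (fun u => u \in take j s)))
        (ideal_gen (monomials (fun u => u = nth 0%MM s j))) f
  <-> ideal_gen (variables (colon_vars s j)) f.
Proof.
move=> uniq_s lqs ltj; rewrite ideal_gen_variablesP; split=> [f_col m mf | fV g].
  have /f_col/ideal_gen_monomialsP H :
      ideal_gen (monomials (fun u => u = nth 0%MM s j)) ('X_[nth 0%MM s j] : {mpoly K[n]}).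
    apply/ideal_gen_monomialsP => u /mem_msuppXP <-.
    by exists (nth 0%MM s j) => //; apply: lepm_refl.
  apply: colon_varsP => //; apply: H.
  by rewrite (perm_mem (msuppMX _ _)) map_f.
move/ideal_gen_monomialsP => gs; apply/ideal_gen_monomialsP => m.
move/msuppM_le => /allpairsP[[m1 m2] /= [/fV[a Va m1a] /gs[_ -> le_s] ->]].
move: Va; rewrite inE => /hasP[v v_lt le_v]; exists v => //.
apply: lepm_trans le_v _; rewrite addmC; apply/mnm_lepP => i.
rewrite !mnmDE mnm1E leq_add ?(mnm_lepP le_s) //.
by case: eqP => [<-|].
Qed.

End MonomialIdeals.

(** * Modules with linear quotients and their syzygies *)

Section LinearSyzygies.
Variables (K : fieldType) (n : nat).
Local Notation P := {mpoly K[n]}.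

(** The rows of [G], listed by increasing [h], have linear quotients: the
    colon ideal of the rows before the [j]-th one by the latter is generated by
    the variables of [V j]. An element of that colon ideal is the leading
    coefficient of a syzygy of [G] whose last nonzero position is [j]. *)
Record linear_syzygies (r s : nat) (G : 'M[P]_(r, s)) (V : 'I_r -> {set 'I_n})
    (h : 'I_r -> nat) : Prop := LinearSyzygies {
  linsyz_inj : injective h;
  linsyz_lead : forall (w : 'rV[P]_r) j, w *m G = 0 ->
    (forall i, (h j < h i)%N -> w 0 i = 0) -> in_variables (V j) (w 0 j);
  linsyz_var : forall j a, a \in V j -> exists w : 'rV[P]_r,
    [/\ w *m G = 0, forall i, (h j < h i)%N -> w 0 i = 0 & w 0 j = 'X_a]
}.

Lemma pihomogM d e (p q : P) :
  q \is e.-homog -> pihomog mdeg (d + e) (p * q) = pihomog mdeg d p * q.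
Proof.
move=> q_hom; rewrite {1}[p]mpolyE mulr_suml raddf_sum /= pihomogE mulr_suml.
rewrite [RHS]big_mkcond; apply: eq_bigr => m _ /=.
rewrite -scalerAl linearZ /=; have Xm : ('X_[m] : P) \is (mdeg m).-homog by rewrite dhomogX.
have Xmq := dhomogM Xm q_hom.
have [<-|neq_d] := eqVneq (mdeg m) d; first by rewrite (pihomog_dE Xmq).
by rewrite (pihomog_ne0 _ Xmq) ?scaler0 ?eqn_add2r.
Qed.

Lemma pihomog_syzygy r s (G : 'M[P]_(r, s)) d e (w : 'rV[P]_r) :
  (forall i j, G i j \is e.-homog) -> w *m G = 0 ->
  map_mx (pihomog mdeg d) w *m G = 0.
Proof.
move=> G_hom wG; apply/rowP => j; rewrite !mxE.
transitivity (pihomog mdeg (d + e) ((w *m G) 0 j)); last by rewrite wG mxE raddf0.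
rewrite mxE raddf_sum /=; apply: eq_bigr => i _.
by rewrite mxE pihomogM.
Qed.

(** When [G] has homogeneous entries, the syzygies with leading coefficient a
    variable may be taken to consist of linear forms. *)
Lemma linsyz_var_homog r s (G : 'M[P]_(r, s)) V h e :
  linear_syzygies G V h -> (forall i j, G i j \is e.-homog) ->
  exists W : 'I_r -> 'I_n -> 'rV[P]_r, forall j a,
    (forall l, W j a 0 l \is 1.-homog) /\
    (a \in V j -> [/\ W j a *m G = 0,
      forall i, (h j < h i)%N -> W j a 0 i = 0 & W j a 0 j = 'X_a]).
Proof.
move=> linG G_hom.
suff /choice[W HW] : forall p : 'I_r * 'I_n, exists w : 'rV[P]_r,
    (forall l, w 0 l \is 1.-homog) /\ (p.2 \in V p.1 ->
    [/\ w *m G = 0, forall i, (h p.1 < h i)%N -> w 0 i = 0 & w 0 p.1 = 'X_(p.2)]).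
  by exists (fun j a => W (j, a)) => j a; apply: (HW (j, a)).
move=> [j a] /=; have [Va|nVa] := boolP (a \in V j); last first.
  by exists 0; split=> // l; rewrite mxE dhomog0.
have [w [wG w_lead w_j]] := linsyz_var linG Va.
exists (map_mx (pihomog mdeg 1) w); split=> [l|_]; first by rewrite mxE pihomogP.
split; first exact: pihomog_syzygy wG.
  by move=> i /w_lead wi; rewrite mxE wi raddf0.
by rewrite mxE w_j pihomog_dE // dhomogX /= mdeg1.
Qed.

Lemma ltn_lexkey m x y u v : (u < m)%N -> (v < m)%N ->
  (x * m + u < y * m + v)%N = (x < y)%N || (x == y) && (u < v)%N.
Proof. by move=> um vm; case: (ltngtP x y) => [xy|yx|->] /=; nia. Qed.

Section Step.
Variables (r s : nat) (G : 'M[P]_(r, s)) (V : 'I_r -> {set 'I_n}) (h : 'I_r -> nat).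
Variable (W : 'I_r -> 'I_n -> 'rV[P]_r).
Hypothesis linG : linear_syzygies G V h.
Hypothesis HW : forall j a, a \in V j -> [/\ W j a *m G = 0,
  forall i, (h j < h i)%N -> W j a 0 i = 0 & W j a 0 j = 'X_a].

(** The pairs of a row and a variable of its colon ideal. *)
Definition syz_index : {set 'I_r * 'I_n} := [set p | p.2 \in V p.1].

(** The chosen syzygies, one for each variable of each colon ideal. *)
Definition syz_mx : 'M[P]_(#|syz_index|, r) :=
  \matrix_(b < #|syz_index|) W (enum_val b).1 (enum_val b).2.

(** The variables of the colon ideal of the syzygy [(j, v)]: those variables of
    the colon ideal of row [j] that come before [v]. *)
Definition syz_vars (b : 'I_#|syz_index|) : {set 'I_n} :=
  [set a in V (enum_val b).1 | (a < (enum_val b).2)%N].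

(** The syzygies are listed by leading position, then by leading variable. *)
Definition syz_rank (b : 'I_#|syz_index|) : nat :=
  (h (enum_val b).1 * n + (enum_val b).2)%N.

Lemma syz_indexP (b : 'I_#|syz_index|) : (enum_val b).2 \in V (enum_val b).1.
Proof. by have := enum_valP b; rewrite inE. Qed.

Lemma syz_mx_mul : syz_mx *m G = 0.
Proof.
by apply/row_matrixP => b; rewrite row_mul rowK row0; case: (HW (syz_indexP b)).
Qed.

(** Any syzygy is reduced to zero by cancelling its leading coefficients. The
    bound on the positions involved is what the S-pairs need. *)
Lemma syz_mx_span N (z : 'rV[P]_r) :
  z *m G = 0 -> (forall i, (N <= h i)%N -> z 0 i = 0) ->
  exists2 c : 'rV[P]_#|syz_index|, c *m syz_mx = z &
    forall b, (N <= h (enum_val b).1)%N -> c 0 b = 0.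
Proof.
elim: N z => [|N IH] z zG z_lead.
  exists 0 => [|b _]; last by rewrite mxE.
  by rewrite mul0mx; apply/rowP => i; rewrite z_lead // mxE.
have [/existsP[j /eqP hj] | /existsPn noN] := boolP [exists j, h j == N]; last first.
  have [|c cz c_lead] := IH z zG.
    move=> i; rewrite leq_eqVlt eq_sym (negbTE (noN i)); exact: z_lead.
  by exists c => // b /ltnW; apply: c_lead.
have [|a za] := @in_variables_sum _ _ (V j) (z 0 j).
  by apply: (linsyz_lead linG zG) => i; rewrite hj; apply: z_lead.
(* the combination of syzygies that has the same leading term as z *)
pose c0 : 'rV[P]_#|syz_index| :=
  \row_b (if (enum_val b).1 == j then a (enum_val b).2 else 0).
have c0E l : (c0 *m syz_mx) 0 l = \sum_(v in V j) a v * W j v 0 l.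
  pose F (p : 'I_r * 'I_n) := (if p.1 == j then a p.2 else 0) * W p.1 p.2 0 l.
  rewrite mxE (eq_bigr (fun b => F (enum_val b))) => [|b _]; last by rewrite !mxE.
  rewrite -big_enum_val /= (eq_bigl (fun p => true && (p.2 \in V p.1))); last first.
    by move=> p; rewrite inE.
  rewrite -(pair_big_dep xpredT (fun i v => v \in V i) (fun i v => F (i, v))) /=.
  rewrite (bigD1 j) //= [X in _ + X]big1 ?addr0 => [|i /negbTE neq_ij].
    by apply: eq_bigr => v _; rewrite /F eqxx.
  by apply: big1 => v _; rewrite /F /= neq_ij mul0r.
have c0G : c0 *m syz_mx *m G = 0 by rewrite -mulmxA syz_mx_mul mulmx0.
have [||c cz c_lead] := IH (z - c0 *m syz_mx).
- by rewrite mulmxBl zG c0G subr0.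
- move=> i; rewrite 2!mxE c0E leq_eqVlt => /orP[/eqP eqN | ltN].
    have <- : j = i by apply: (linsyz_inj linG); rewrite hj.
    rewrite za [X in _ - X](eq_bigr (fun v => a v * 'X_v)) ?subrr // => v Vv.
    by case: (HW Vv) => _ _ ->.
  rewrite z_lead // big1 ?subr0 // => v Vv.
  by have [_ W_lead _] := HW Vv; rewrite W_lead ?mulr0 ?hj.
exists (c + c0); first by rewrite mulmxDl cz subrK.
move=> b ltN; rewrite mxE c_lead ?add0r; last exact: ltnW.
by rewrite mxE; case: eqP => // eqj; move: ltN; rewrite eqj hj ltnn.
Qed.

Lemma syz_mx_exact (z : 'rV[P]_r) : z *m G = 0 <-> exists c, c *m syz_mx = z.
Proof.
split=> [zG|[c <-]]; last by rewrite -mulmxA syz_mx_mul mulmx0.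
have [|c cz _] := @syz_mx_span (\max_i h i).+1 z zG; last by exists c.
by move=> i; rewrite ltnNge leq_bigmax.
Qed.

Lemma syz_rank_ltn b b' : (syz_rank b < syz_rank b')%N =
  (h (enum_val b).1 < h (enum_val b').1)%N ||
  (h (enum_val b).1 == h (enum_val b').1) && ((enum_val b).2 < (enum_val b').2)%N.
Proof. exact: ltn_lexkey. Qed.

Lemma syz_rank_inj : injective syz_rank.
Proof.
move=> b b' eq_bb'; apply: enum_val_inj; move: eq_bb'; rewrite /syz_rank.
case: (enum_val b) (enum_val b') => [j v] [j' v'] /= eq_key.
have [ltn1 ltn2] : (h j * n + v < h j' * n + v')%N = false /\
    (h j' * n + v' < h j * n + v)%N = false by rewrite eq_key ltnn.
rewrite ltn_lexkey // in ltn1; rewrite ltn_lexkey // in ltn2.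
have eq_h : h j = h j' by lia.
have eq_v : v = v' by apply: val_inj => /=; lia.
by rewrite eq_v (linsyz_inj linG eq_h).
Qed.

(** At position [j], a relation ending at the syzygy [(j, v)] expresses the
    product of its leading coefficient by [v] through the earlier variables of
    [V j]; the ideal that these generate is prime and does not contain [v]. *)
Lemma syz_mx_lead (c : 'rV[P]_#|syz_index|) b :
  c *m syz_mx = 0 -> (forall b', (syz_rank b < syz_rank b')%N -> c 0 b' = 0) ->
  in_variables (syz_vars b) (c 0 b).
Proof.
move=> cD c_lead m mc; set j := (enum_val b).1; set v := (enum_val b).2.
have eq_cb : c 0 b * 'X_v = - \sum_(b' | b' != b) c 0 b' * syz_mx b' j.
  have /matrixP/(_ 0 j) := cD; rewrite !mxE (bigD1 b) //= => /eqP.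
  rewrite addr_eq0 => /eqP <-; congr (_ * _).
  by rewrite mxE; case: (HW (syz_indexP b)).
have : (U_(v) + m)%MM \in msupp (c 0 b * 'X_v) by rewrite (perm_mem (msuppMX _ _)) map_f.
rewrite eq_cb (perm_mem (msuppN _)) => /msupp_sumP[b' neq_b'].
have [/c_lead->|] := ltnP (syz_rank b) (syz_rank b'); first by rewrite mul0r msupp0.
rewrite leq_eqVlt => /orP[/eqP/syz_rank_inj eq_b'|]; first by rewrite eq_b' eqxx in neq_b'.
have [_ W_lead W_j] := HW (syz_indexP b').
rewrite syz_rank_ltn mxE => /orP[lt_h | /andP[/eqP/(linsyz_inj linG) eq_j lt_v]].
  by rewrite W_lead // mulr0 msupp0.
rewrite /j -eq_j W_j (perm_mem (msuppMX _ _)) => /mapP[m' _ eq_m].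
exists (enum_val b').2.
  by rewrite inE lt_v andbT -eq_j syz_indexP.
have /mnmP/(_ (enum_val b').2) := eq_m; rewrite !mnmDE !mnm1E eqxx.
have [eq_v|_] := eqVneq v (enum_val b').2; last by lia.
by move: lt_v; rewrite -/v eq_v ltnn.
Qed.

Lemma syz_mx_linear : linear_syzygies syz_mx syz_vars syz_rank.
Proof.
split; [exact: syz_rank_inj | by move=> c b; apply: syz_mx_lead |].
move=> b a; rewrite inE => /andP[Va lt_a].
set j := (enum_val b).1 in Va; set v := (enum_val b).2 in lt_a.
have [Wv_syz Wv_lead Wv_j] := HW (syz_indexP b).
have [Wa_syz Wa_lead Wa_j] := HW Va.
have ja_idx : (j, a) \in syz_index by rewrite inE.
pose b2 := enum_rank_in ja_idx (j, a).
have b2E : enum_val b2 = (j, a) by rewrite enum_rankK_in.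
(* the S-pair of the two syzygies with leading position j *)
pose z := 'X_a *: W j v - 'X_v *: W j a : 'rV[P]_r.
have [||c cz c_lead] := @syz_mx_span (h j) z.
- by rewrite mulmxBl -!scalemxAl Wv_syz Wa_syz !scaler0 subrr.
- move=> i; rewrite leq_eqVlt => /orP[/eqP/(linsyz_inj linG) <- | lt_h].
    by rewrite !mxE Wv_j Wa_j mulrC subrr.
  by rewrite !mxE Wv_lead // Wa_lead // !mulr0 subrr.
exists ('X_a *: delta_mx 0 b - 'X_v *: delta_mx 0 b2 - c); split.
- rewrite !mulmxBl -!scalemxAl -!rowE !rowK cz b2E /=.
  by rewrite subrr.
- move=> b' lt_b'.
  have lt_b2 : (syz_rank b2 < syz_rank b)%N by rewrite syz_rank_ltn b2E eqxx lt_a orbT.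
  have le_h : (h j <= h (enum_val b').1)%N.
    by move: lt_b'; rewrite syz_rank_ltn => /orP[/ltnW|/andP[/eqP<-]].
  have neq_b : b' != b by apply: contraTneq lt_b' => ->; rewrite ltnn.
  have neq_b2 : b' != b2 by apply: contraTneq lt_b' => ->; rewrite -leqNgt ltnW.
  by rewrite !mxE (negbTE neq_b) (negbTE neq_b2) !andbF !mulr0 c_lead // !subrr.
have neq_b2 : b != b2 by apply: contraTneq lt_a => bE; rewrite /v bE b2E ltnn.
by rewrite !mxE !eqxx (negbTE neq_b2) andbF mulr0 mulr1 c_lead // !subr0.
Qed.

End Step.

End LinearSyzygies.

(** * Linear resolutions *)

Section LinearResolution.
Variables (K : fieldType) (n : nat).
Local Notation P := {mpoly K[n]}.

(** A matrix with homogeneous entries of one degree whose rows have linear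
    quotients. *)
Record linear_module := LinearModule {
  lmod_rows : nat;
  lmod_cols : nat;
  lmod_mx : 'M[P]_(lmod_rows, lmod_cols);
  lmod_vars : 'I_lmod_rows -> {set 'I_n};
  lmod_rank : 'I_lmod_rows -> nat;
  lmod_deg : nat;
  lmod_homog : forall i j, lmod_mx i j \is lmod_deg.-homog;
  lmod_linear : linear_syzygies lmod_mx lmod_vars lmod_rank
}.

Section Next.
Variable M : linear_module.

Let W := projT1 (cid (linsyz_var_homog (lmod_linear M) (@lmod_homog M))).
Let WP := projT2 (cid (linsyz_var_homog (lmod_linear M) (@lmod_homog M))).
Let HW j a (Va : a \in lmod_vars j) := (WP j a).2 Va.

Let next_homog i j : syz_mx (lmod_vars (l := M)) W i j \is 1.-homog.
Proof. by rewrite mxE; case: (WP (enum_val i).1 (enum_val i).2). Qed.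

(** The syzygies of [M]. *)
Definition lmod_next : linear_module :=
  LinearModule next_homog (syz_mx_linear (lmod_linear M) HW).

Lemma lmod_next_exact (z : 'rV[P]_(lmod_rows M)) :
  z *m lmod_mx M = 0 <->
  exists c : 'rV[P]_(lmod_rows lmod_next), c *m lmod_mx lmod_next = z.
Proof. exact: (syz_mx_exact (lmod_linear M) HW). Qed.

End Next.

Fixpoint lmod_iter (M : linear_module) (i : nat) : linear_module :=
  if i is i'.+1 then lmod_next (lmod_iter M i') else M.

(** The iterated syzygies of a column with linear quotients form a graded free
    resolution; it is minimal because all its maps consist of linear forms. *)
Lemma linear_resolution d r (G : 'cV[P]_r) V h (I : P -> Prop) :
  (forall i j, G i j \is d.-homog) -> linear_syzygies G V h ->
  (forall f, I f <-> exists v : 'rV[P]_r, (v *m G) 0 0 = f) ->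
  has_linear_resolution d I.
Proof.
move=> G_hom linG I_G.
pose M := lmod_iter (LinearModule G_hom linG).
pose D i : 'M[P]_(lmod_rows (M i.+1), lmod_rows (M i)) := lmod_mx (M i.+1).
have D_hom i j l : D i j l \is 1.-homog by apply: lmod_homog.
have D_exact i (v : 'rV[P]_(lmod_rows (M i.+1))) :
    v *m D i = 0 <-> exists w : 'rV[P]_(lmod_rows (M i.+2)), w *m D i.+1 = v.
  exact: (lmod_next_exact (M := M i.+1)).
have G_exact (v : 'rV[P]_(lmod_rows (M 0))) :
    v *m G = 0 <-> exists w : 'rV[P]_(lmod_rows (M 1%N)), w *m D 0 = v.
  exact: (lmod_next_exact (M := M 0)).
have D_twist i (j : 'I_(lmod_rows (M i.+1))) (l : 'I_(lmod_rows (M i))) m :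
    m \in msupp (D i j l) -> (mdeg m + (d + i))%N = (d + i.+1)%N.
  by move=> /(dhomog_mf (D_hom i j l)) /= ->; lia.
have G_twist (j : 'I_(lmod_rows (M 0))) : G j 0 \is (d + 0).-homog by rewrite addn0.
exists (@GradedFreeResolution K n I (fun i => lmod_rows (M i)) (fun i _ => (d + i)%N)
  G D G_twist D_twist I_G G_exact D_exact) => //.
move=> i j l /=; apply: (dhomog_nemf_coeff (D_hom i j l)).
by rewrite /= mdeg0.
Qed.

(** The leading syzygies of monomials with linear quotients: a variable of the
    [j]-th colon ideal comes from an earlier generator [u] dividing
    [s_j x_a], and gives a syzygy with two nonzero entries. *)
Lemma monomial_linear_syzygies d (s : seq 'X_{1..n}) :
  uniq s -> monomial_lq s -> {in s, forall u, mdeg u = d} ->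
  linear_syzygies (\col_(i < size s) 'X_[nth 0%MM s i] : 'cV[P]_(size s))
    (fun i => colon_vars s i) (@nat_of_ord (size s)).
Proof.
move=> uniq_s lqs deg_s; split; first exact: val_inj.
  move=> w j wG w_lead m wm; apply: colon_varsP => //.
  have eq_w : w 0 j * 'X_[nth 0%MM s j]
      = - \sum_(i < size s | i != j) w 0 i * 'X_[nth 0%MM s i].
    have /rowP/(_ 0) := wG; rewrite !mxE (bigD1 j) //= mxE => /eqP.
    rewrite addr_eq0 => /eqP ->; congr (- _).
    by apply: eq_bigr => i _; rewrite mxE.
  have : (nth 0 s j + m)%MM \in msupp (w 0 j * 'X_[nth 0%MM s j]).
    by rewrite (perm_mem (msuppMX _ _)) map_f.
  rewrite eq_w (perm_mem (msuppN _)) => /msupp_sumP[i neq_ij].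
  have [/w_lead->|le_ij] := ltnP j i; first by rewrite mul0r msupp0.
  rewrite (perm_mem (msuppMX _ _)) => /mapP[m' _ eq_m].
  exists (nth 0%MM s i); last by rewrite eq_m lem_addr.
  rewrite in_take ?mem_nth // index_uniq //.
  by rewrite ltn_neqAle le_ij andbT (inj_eq val_inj).
move=> j a; rewrite inE => /hasP[u /[dup] /mem_take us u_lt le_u].
rewrite in_take // in u_lt.
have lt_u : (index u s < size s)%N by rewrite index_mem.
pose i := Ordinal lt_u.
have neq_ij : i != j by rewrite -(inj_eq val_inj) /= ltn_eqF.
exists ('X_a *: delta_mx 0 j - 'X_[(nth 0 s j + U_(a) - u)%MM] *: delta_mx 0 i); split.
- rewrite mulmxBl -!scalemxAl -!rowE; apply/rowP => l; rewrite !mxE /=.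
  by rewrite nth_index // -!mpolyXD submK // addmC subrr.
- move=> l lt_jl.
  have neq_lj : l != j by apply: contraTneq lt_jl => ->; rewrite ltnn.
  have neq_li : l != i by apply: contraTneq lt_jl => ->; rewrite -leqNgt ltnW.
  by rewrite !mxE (negbTE neq_lj) (negbTE neq_li) !mulr0 subrr.
by rewrite !mxE !eqxx [j == i]eq_sym (negbTE neq_ij) mulr1 mulr0 subr0.
Qed.

Lemma monomial_lq_linear_resolution d (s : seq 'X_{1..n}) (I : P -> Prop) :
  uniq s -> monomial_lq s -> {in s, forall u, mdeg u = d} ->
  (forall f, I f <-> ideal_gen (monomials (fun u => u \in s)) f) ->
  has_linear_resolution d I.
Proof.
move=> uniq_s lqs deg_s I_s.
pose G : 'cV[P]_(size s) := \col_(i < size s) 'X_[nth 0%MM s i].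
apply: (linear_resolution (G := G) _ (monomial_linear_syzygies uniq_s lqs deg_s)).
  by move=> i j; rewrite mxE dhomogX /= deg_s ?mem_nth.
move=> f; rewrite I_s; split=> [|[v <-]]; last first.
  exists (size s), (v 0), (fun i => 'X_[nth 0%MM s i]); split=> [i|].
    by exists (nth 0%MM s i) => //; apply: mem_nth.
  by rewrite mxE; apply: eq_bigr => i _; rewrite mxE.
case=> r [c [g [g_mon ->]]].
apply: (big_ind (fun f => exists v : 'rV[P]_(size s), (v *m G) 0 0 = f)).
- by exists 0; rewrite mul0mx mxE.
- by move=> _ _ [v1 <-] [v2 <-]; exists (v1 + v2); rewrite mulmxDl mxE.
move=> i _; have [u us ->] := g_mon i.
have lt_u : (index u s < size s)%N by rewrite index_mem.
exists (c i *: delta_mx 0 (Ordinal lt_u)).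
by rewrite -scalemxAl -rowE !mxE nth_index.
Qed.

End LinearResolution.

(** * k-Borel ideals *)

Section KBorelIdeals.
Variables (K : fieldType) (n k : nat) (I : {mpoly K[n]} -> Prop).
Hypothesis I_Borel : k_Borel k I.

(** The monomials of [I], as a boolean predicate. *)
Definition ideal_mons : pred 'X_{1..n} := fun u => `[< I 'X_[u] >].

Lemma ideal_monsP f : I f <-> forall m, m \in msupp f -> ideal_mons m.
Proof.
have [[A _ genI] _] := I_Borel.
rewrite genI ideal_gen_monomialsP; split=> H m /H.
  by move=> Am; apply/asboolP/(memI_monomial _ genI).
by move/asboolP/(memI_monomial _ genI).
Qed.

Lemma kBorel_ideal_mons : kBorel_mons k ideal_mons.
Proof.
have [[A bA genI] movI] := I_Borel.
have up u v : ideal_mons u -> (u <= v)%MM -> ideal_mons v.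
  move=> /asboolP/(memI_monomial _ genI)[w Aw wu] uv.
  apply/asboolP/(memI_monomial _ genI); exists w => //; exact: lepm_trans uv.
split=> // [u min_u | u i j bu /asboolP Iu uj ij bm].
  have /andP[/asboolP/(memI_monomial _ genI)[w Aw wu] _] := min_u.
  have Jw : ideal_mons w.
    by apply/asboolP/(memI_monomial _ genI); exists w => //; apply: lepm_refl.
  by rewrite -(minimal_mon_uniq up min_u Jw wu); apply: bA.
by apply/asboolP; apply: movI => //; rewrite inE.
Qed.

Let s := kBorel_gens k ideal_mons.

Lemma ideal_mons_gens m : ideal_mons m = has (fun u => u <= m)%MM s.
Proof.
apply/idP/hasP => [/minimal_mon_exists[u min_u um] | [u]].
  by exists u => //; rewrite mem_kBorel_gens //; apply: kBorel_ideal_mons.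
rewrite mem_kBorel_gens; last exact: kBorel_ideal_mons.
by case/andP=> Ju _; apply: (kBorel_up kBorel_ideal_mons).
Qed.

Lemma minimal_generators_kBorel : minimal_monomial_generators I (fun u => u \in s).
Proof.
have Jk := kBorel_ideal_mons; split=> [f | B Bs genB u us].
  rewrite ideal_gen_monomialsP ideal_monsP; split=> H m /H.
    by rewrite ideal_mons_gens => /hasP.
  by move=> ?; rewrite ideal_mons_gens; apply/hasP.
have min_u : minimal_mon ideal_mons u by rewrite -(mem_kBorel_gens Jk).
have /andP[/asboolP/(memI_monomial _ genB)[v Bv vu] _] := min_u.
have /andP[Jv _] : minimal_mon ideal_mons v by rewrite -(mem_kBorel_gens Jk) Bs.
by rewrite -(minimal_mon_uniq (kBorel_up Jk) min_u Jv vu).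
Qed.

Lemma kBorel_linear_quotients : has_linear_quotients I.
Proof.
have Jk := kBorel_ideal_mons.
exists s; split; [exact: uniq_kBorel_gens | exact: minimal_generators_kBorel |].
move=> j /andP[_ ltj]; exists (colon_vars s j) => f.
by apply: monomial_lq_colon => //; [apply: uniq_kBorel_gens | apply: monomial_lq_kBorel_gens].
Qed.

Lemma degree_component_gens d f :
  degree_component_ideal d I f <->
  ideal_gen (monomials (fun u => u \in degree_part s d)) f.
Proof.
split; last first.
  apply: ideal_gen_mono => g [u]; rewrite mem_degree_part => /andP[/eqP du us] ->.
  split; last by rewrite dhomogX /= du.
  by apply/asboolP; change (ideal_mons u); rewrite ideal_mons_gens.
case=> r [c [g [gI ->]]]; apply/ideal_gen_monomialsP => m /msupp_sumP[i _].
have [/ideal_monsP Ig /dhomogP hom_g] := gI i.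
move/msuppM_le => /allpairsP[[m1 m2] /= [_ gm2 ->]]; exists m2; last exact: lem_addl.
by rewrite mem_degree_part -ideal_mons_gens Ig // [mdeg _](hom_g _ gm2) eqxx.
Qed.

Lemma kBorel_componentwise_linear : componentwise_linear I.
Proof.
have Jk := kBorel_ideal_mons; move=> d; left.
apply: (monomial_lq_linear_resolution _ _ _ (degree_component_gens d)).
- exact: uniq_degree_part.
- apply: monomial_lq_degree_part; first exact: monomial_lq_kBorel_gens.
  exact: kBorel_gens_mdeg.
by move=> u; rewrite mem_degree_part => /andP[/eqP].
Qed.

End KBorelIdeals.

Theorem proposition2p6 (K : fieldType) (k n : nat) (hk : (1 <= k)%N)
    (I : {mpoly K[n]} -> Prop) (hI : k_Borel k I) :
  has_linear_quotients I /\ componentwise_linear I.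
Proof.
by split; [apply: kBorel_linear_quotients hI | apply: kBorel_componentwise_linear hI].
Qed.
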